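(* Assume the 3D pendulum has a single axis of symmetry and the pivot and the center of mass are located on the axis of symmetry, with body-fixed axes chosen so that $J=\mathrm{diag}(J_t,J_t,J_a)$ and $\rho=\rho_s e_3$ with $\rho_s>0$. Then the equations of motion of the 3D pendulum $$J\dot\omega=J\omega\times\omega+mg\,\rho\times\Gamma,\qquad \dot\Gamma=\Gamma\times\omega$$ on $S^2\times\mathbb{R}^3$ define an induced flow on the fiber bundle $S^2\times\mathbb{R}^2$ corresponding to $\omega_z=0$, given by $$J_t\dot\omega_x=-mg\rho_s\Gamma_y,\qquad J_t\dot\omega_y=mg\rho_s\Gamma_x,\qquad \dot\Gamma=\Gamma\times[\,\omega_x\ \ \omega_y\ \ 0\,]^T.$$
   Context: $\Gamma=(\Gamma_x,\Gamma_y,\Gamma_z)=R^Te_3\in S^2$ is the gravity direction in the body-fixed frame ($R\in SO(3)$ the attitude of the rigid body, $e_3=(0,0,1)^T$), $\omega=(\omega_x,\omega_y,\omega_z)\in\mathbb{R}^3$ is the body-fixed angular velocity, $J$ is the inertia matrix (body frame, origin at the pivot; $J_t,J_a>0$), $m>0$ the mass, $g>0$ the gravitational acceleration, $\rho$ the body-fixed vector from the pivot to the center of mass. ''Induced flow corresponding to $\omega_z=0$'' means that the set $\{(\Gamma,\omega):\omega_z=0\}\cong S^2\times\mathbb{R}^2$, with coordinates $(\Gamma,\omega_x,\omega_y)$, is invariant under the dynamics and the restricted dynamics are the displayed equations (those of a 2D spherical pendulum). *)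

(* Defs.v *)
From HB Require Import structures.
From mathcomp Require Import all_boot all_order all_algebra.
From mathcomp Require Import all_classical all_reals all_analysis.

Set Implicit Arguments.
Unset Strict Implicit.
Unset Printing Implicit Defensive.

Import Order.TTheory GRing.Theory Num.Theory.
Import numFieldNormedType.Exports.

Local Open Scope classical_set_scope.
Local Open Scope ring_scope.

Section Pendulum.
Context {R : realType}.

(* Vectors of R^3 are columns; their x, y, z components have the ordinals
   0, 1, 2 : 'I_3 as row index. *)
Definition vec3 (a b c : R) : 'cV[R]_3 := \col_(i < 3) [:: a; b; c]`_i.

Definition e3 : 'cV[R]_3 := vec3 0 0 1.

Definition cross (u v : 'cV[R]_3) : 'cV[R]_3 :=
  vec3 (u 1 0 * v 2 0 - u 2 0 * v 1 0)
       (u 2 0 * v 0 0 - u 0 0 * v 2 0)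
       (u 0 0 * v 1 0 - u 1 0 * v 0 0).

(* The Euclidean sphere: the library norm `|_| on matrices is the sup norm,
   hence the explicit sum of squares. *)
Definition sphere2 : set 'cV[R]_3 := [set x | \sum_(i < 3) x i 0 ^+ 2 = 1].

(* Solution curves in S^2 x R^3, on a set I of times, of
     J omega' = J omega x omega + m g rho x Gamma,  Gamma' = Gamma x omega.
   Differentiability is explicit because derive1 is total. *)
Definition pendulum3D_solution (J : 'M[R]_3) (m g : R) (rho : 'cV[R]_3)
    (I : set R) (Gamma omega : R -> 'cV[R]_3) : Prop :=
  forall t, I t ->
    [/\ sphere2 (Gamma t),
        derivable Gamma t 1,
        derivable omega t 1,
        J *m derive1 omega t =
          cross (J *m omega t) (omega t) + (m * g) *: cross rho (Gamma t)
      & derive1 Gamma t = cross (Gamma t) (omega t)].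

(* Solution curves in S^2 x R^2, with coordinates (Gamma, omegax, omegay), of
   the equations of a 2D spherical pendulum. *)
Definition spherical_pendulum_solution (Jt m g rhos : R)
    (I : set R) (Gamma : R -> 'cV[R]_3) (omegax omegay : R -> R) : Prop :=
  forall t, I t ->
    [/\ sphere2 (Gamma t),
        derivable Gamma t 1,
        derivable omegax t 1 /\ derivable omegay t 1,
        Jt * derive1 omegax t = - (m * g * rhos * Gamma t 1 0) /\
        Jt * derive1 omegay t = m * g * rhos * Gamma t 0 0
      & derive1 Gamma t = cross (Gamma t) (vec3 (omegax t) (omegay t) 0)].

(* Invariance forwards and backwards in time, along every solution defined on
   an open interval. *)
Definition pendulum3D_invariant (J : 'M[R]_3) (m g : R) (rho : 'cV[R]_3)
    (M : set ('cV[R]_3 * 'cV[R]_3)) : Prop :=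
  forall (I : set R) (Gamma omega : R -> 'cV[R]_3),
    open I -> is_interval I ->
    pendulum3D_solution J m g rho I Gamma omega ->
    forall t0, I t0 -> M (Gamma t0, omega t0) ->
    forall t, I t -> M (Gamma t, omega t).

End Pendulum.

(* Main.v *)
(* Since [rho] is along [e3], [rho x Gamma] has no third component, and neither has
   [J omega x omega], because the two transverse moments of inertia agree.  The
   third Euler equation is thus [Ja omega_z' = 0], so that [omega_z] is constant
   along solutions; setting [omega_z = 0] in the other two equations leaves those
   of the spherical pendulum. *)
Require Import Defs.
From HB Require Import structures.
From mathcomp Require Import all_boot all_order all_algebra.
From mathcomp Require Import all_classical all_reals all_analysis.
From mathcomp Require Import ring.

Set Implicit Arguments.
Unset Strict Implicit.
Unset Printing Implicit Defensive.

Import Order.TTheory GRing.Theory Num.Theory.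
Import numFieldNormedType.Exports.

Local Open Scope classical_set_scope.
Local Open Scope ring_scope.

Lemma ord3_cases (i : 'I_3) : [\/ i = 0, i = 1 | i = 2].
Proof.
case: i => [[|[|[|//]]] i3];
  [constructor 1|constructor 2|constructor 3]; exact/val_inj.
Qed.

Lemma vec3_eta (R : realType) (u : 'cV[R]_3) : u = vec3 (u 0 0) (u 1 0) (u 2 0).
Proof.
by apply/colP => i; rewrite !mxE; case: (ord3_cases i) => ->.
Qed.

Lemma vec3_inj (R : realType) (a b c a' b' c' : R) :
  vec3 a b c = vec3 a' b' c' <-> [/\ a = a', b = b' & c = c'].
Proof.
split=> [/colP e|[-> -> ->]//].
by have := (e 0, e 1, e 2); rewrite !mxE /= => -[[-> ->] ->].
Qed.

(** Both gyroscopic terms carry the factor [u 2 0], so at zero axial spin only the gravity torque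
    survives in the transverse equations. The acceleration [a] is a free vector, which makes the
    equivalence pure algebra, usable both to read off and to rebuild the Euler equations along a
    curve. *)
Lemma symmetric_top_eqP (R : realType) (m g Jt Ja rhos : R)
    (a u G : 'cV[R]_3) :
  let J := diag_mx (vec3 Jt Jt Ja)^T in
  J *m a = cross (J *m u) u + (m * g) *: cross (rhos *: e3) G <->
  [/\ Jt * a 0 0 = (Jt - Ja) * u 1 0 * u 2 0 - m * g * rhos * G 1 0,
      Jt * a 1 0 = (Ja - Jt) * u 0 0 * u 2 0 + m * g * rhos * G 0 0
    & Ja * a 2 0 = 0].
Proof.
move=> J.
have JE (v : 'cV_3) : J *m v = vec3 (Jt * v 0 0) (Jt * v 1 0) (Ja * v 2 0).
  by rewrite mul_diag_mx; apply/colP => i; rewrite !mxE; case: (ord3_cases i) => ->.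
have -> : cross (J *m u) u + (m * g) *: cross (rhos *: e3) G =
    vec3 ((Jt - Ja) * u 1 0 * u 2 0 - m * g * rhos * G 1 0)
         ((Ja - Jt) * u 0 0 * u 2 0 + m * g * rhos * G 0 0) 0.
  rewrite JE; apply/colP => i; rewrite !mxE.
  by case: (ord3_cases i) => -> /=; ring.
by rewrite JE vec3_inj.
Qed.

Lemma derive1_coord (R : realType) (m n : nat) (M : R -> 'M[R]_(m, n)) t i j :
  derivable M t 1 -> derive1 M t i j = derive1 (fun s => M s i j) t.
Proof. by move=> dM; rewrite !derive1E derive_mx// mxE. Qed.

(** The segment between [s] and [t] lies in the interval [I], and on it the mean value theorem
    writes [f t - f s] as a zero derivative times [t - s]. *)
Lemma derive1_0_is_interval_cst (R : realType) (I : set R) (f : R -> R) :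
  is_interval I -> (forall t, I t -> derivable f t 1 /\ derive1 f t = 0) ->
  forall s t, I s -> I t -> f s = f t.
Proof.
move=> itvI df s t Is It; wlog st : s t Is It / s <= t => [H|].
  by have [/H|/ltW/H/esym] := leP s t; exact.
have sub x : x \in `[s, t] -> I x by rewrite in_itv/=; exact: itvI.
have d0 x : x \in `]s, t[ -> is_derive x 1 f (cst 0 x).
  move=> /subset_itv_oo_cc/sub /df[dfx f0].
  by apply: DeriveDef => //; rewrite -derive1E.
have cf : {within `[s, t], continuous f}.
  by apply: derivable_within_continuous => x /sub /df[].
by have [c _] := MVT_segment st d0 cf; rewrite mul0r => /subr0_eq/esym.
Qed.

Section vec3_curve.
Variables (R : realType) (I : set R) (omega : R -> 'cV[R]_3) (x y z : R -> R).
Hypothesis openI : open I.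
Hypothesis omegaE : forall t, I t -> omega t = vec3 (x t) (y t) (z t).

(** The coordinates describe [omega] on [I] only, whereas a derivative at [t] depends on a whole
    neighbourhood; openness of [I] provides it. *)
Lemma vec3_curve_near t : I t -> \near t, omega t = vec3 (x t) (y t) (z t).
Proof.
by move=> It; apply: filterS (open_nbhs_nbhs (conj openI It)).
Qed.

Lemma derivable_vec3_curve t : I t ->
  derivable omega t 1 <-> [/\ derivable x t 1, derivable y t 1 & derivable z t 1].
Proof.
move=> It; have nE := vec3_curve_near It.
have cE i j : (fun s => vec3 (x s) (y s) (z s) i j) = fun s => [:: x s; y s; z s]`_i.
  by apply/funext => s; rewrite mxE.
split=> [/(near_eq_derivable nE)/derivable_mxP d|[dx dy dz]].
  by split; [have := d 0 0|have := d 1 0|have := d 2 0]; rewrite cE.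
apply: (@near_eq_derivable _ _ _ (fun s => vec3 (x s) (y s) (z s))).
  by apply: filterS nE => s ->.
by apply/derivable_mxP => i j; rewrite cE; case: (ord3_cases i) => ->.
Qed.

Lemma derive1_vec3_curve t : I t -> derivable omega t 1 ->
  derive1 omega t = vec3 (derive1 x t) (derive1 y t) (derive1 z t).
Proof.
move=> It dw; have nE := vec3_curve_near It.
have dv := near_eq_derivable nE dw.
rewrite derive1E (near_eq_derive _ nE) -derive1E [LHS]vec3_eta.
rewrite !derive1_coord//.
by congr vec3; congr (derive1 _ t); apply/funext => s; rewrite mxE.
Qed.

End vec3_curve.

Theorem proposition6 (R : realType) (J : 'M[R]_3) (rho : 'cV[R]_3)
    (m g Jt Ja rhos : R)
    (m_gt0 : 0 < m) (g_gt0 : 0 < g) (Jt_gt0 : 0 < Jt) (Ja_gt0 : 0 < Ja)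
    (rhos_gt0 : 0 < rhos)
    (JE : J = diag_mx (vec3 Jt Jt Ja)^T)
    (rhoE : rho = rhos *: e3) :
  pendulum3D_invariant J m g rho
    [set q : 'cV[R]_3 * 'cV[R]_3 | sphere2 q.1 /\ q.2 2 0 = 0] /\
  (forall (I : set R) (Gamma omega : R -> 'cV[R]_3) (omegax omegay : R -> R),
     open I -> is_interval I ->
     (forall t, I t -> omega t = vec3 (omegax t) (omegay t) 0) ->
     (pendulum3D_solution J m g rho I Gamma omega <->
      spherical_pendulum_solution Jt m g rhos I Gamma omegax omegay)).
Proof.
subst J rho; split=> [I Gamma omega openI itvI sol t0 It0 /= [_ w0] t It|].
  split; first by case: (sol t It).
  (* Writing the target value 0 as the spin at [t0] turns invariance into conservation of the axial
     spin between [t0] and [t]. *)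
  rewrite -w0.
  apply: (derive1_0_is_interval_cst (f := fun s => omega s 2 0) itvI) => // s Is.
  have [_ _ dw /symmetric_top_eqP[_ _ /eqP w'0] _] := sol s Is.
  split; first exact: (derivable_mxP _ _ _).1 dw 2 0.
  (* Positivity of [Ja] lets it be cancelled from the third Euler equation. *)
  by apply/eqP; move: w'0; rewrite -derive1_coord// mulf_eq0 gt_eqF.
move=> I Gamma omega x y openI itvI wE.
(* The third coordinate is presented as a constant function, so that the results on coordinate
   curves apply with [z := cst 0]. *)
have wE0 : forall t, I t -> omega t = vec3 (x t) (y t) (cst 0 t) by [].
have w2 t : I t -> omega t 2 0 = 0 by move=> It; rewrite wE// mxE.
have w'E t : I t -> derivable omega t 1 -> [/\ derive1 omega t 0 0 = derive1 x t,
    derive1 omega t 1 0 = derive1 y t & derive1 omega t 2 0 = 0].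
  by move=> It dw; rewrite (derive1_vec3_curve openI wE0)// derive1_cst !mxE.
split=> sol t It.
  have [SG dG dw /symmetric_top_eqP[ex ey _] G'] := sol t It.
  have [dx dy _] := (derivable_vec3_curve openI wE0 It).1 dw.
  have [w'0 w'1 _] := w'E t It dw.
  split=> //; last by rewrite -wE.
  by rewrite -w'0 -w'1 ex ey w2// !mulr0 sub0r add0r.
have [SG dG [dx dy] [ex ey] G'] := sol t It.
(* Conversely, differentiability of [omega] is recovered from its coordinates, the third being
   constant; the axial Euler equation then reduces to [Ja * 0 = 0]. *)
have dw : derivable omega t 1.
  by apply/(derivable_vec3_curve openI wE0 It); split=> //; exact: derivable_cst.
have [w'0 w'1 w'2] := w'E t It dw.
split=> //; last by rewrite wE.
by apply/symmetric_top_eqP; rewrite w'0 w'1 w'2 ex ey w2// !mulr0 sub0r add0r.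
Qed.
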